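(* Let $F_c:\mathbb{R}^n\to\mathbb{R}^n$ be the smoothed function defined in the context, and let $x^*$ be a solution of the system $F_c(x)=0$. Let $m$ be any positive integer, and for a fixed choice of the sign $\pm$ define the sequence $\{x^k\}$ by $$\begin{cases} y_1^k=x^k\pm F_c'(x^k)^{-1}F_c(x^k),\\ y_2^k=y_1^k-F_c'(x^k)^{-1}F_c(y_1^k),\\ \qquad\vdots\\ y_m^k=y_{m-1}^k-F_c'(x^k)^{-1}F_c(y_{m-1}^k),\\ x^{k+1}=y_m^k-F_c'(x^k)^{-1}F_c(y_m^k),\end{cases}\qquad k=0,1,2,\dots$$ (for $m=1$ only the first and last lines are present). Then, for $x^0$ sufficiently close to $x^*$, the sequence $\{x^k\}$ converges to $x^*$ with order $m+2$.
   Context: Let $M\in\mathbb{R}^{n\times n}$, $q\in\mathbb{R}^n$, and $\mu:\mathbb{R}^n\to\mathbb{R}^n$ be a mapping such that $g(z)=z-\mu(z)$ is an invertible function on $\mathbb{R}^n$. Let $\alpha,\beta>0$ be constants, $I$ the $n\times n$ identity matrix, $\Omega=\alpha I$, $A=\beta M$, and let $c$ be a large positive integer. Absolute values, squares, square roots and addition of the scalar $e^{-c}$ are applied to vectors componentwise; thus $(x^2+e^{-c})^{1/2}=\big((x_1^2+e^{-c})^{1/2},\dots,(x_n^2+e^{-c})^{1/2}\big)^{T}$. Define $$F_c(x)=(\Omega+A)x-(\Omega-A)\,(x^2+e^{-c})^{1/2}+M\,\mu(z)+q,\qquad z=g^{-1}\big(\beta(|x|+x)\big).$$ (This smooths the fixed-point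 form of the implicit complementarity problem $z-\mu(z)\ge 0$, $w=Mz+q\ge 0$, $(z-\mu(z))^T(Mz+q)=0$.) $F_c$ is taken to be smooth, and $F_c'(x)$ denotes its Jacobian matrix. The iteration formula presupposes that $F_c'$ is invertible at the points where its inverse is used. Convergence to $x^*$ with order $p$ means $x^k\to x^*$ and $\|x^{k+1}-x^*\|=O(\|x^k-x^*\|^p)$. *)

(* Defs.v *)
From HB Require Import structures.
From mathcomp Require Import all_boot all_order all_algebra.
From mathcomp Require Import all_classical all_reals all_analysis.
Set Implicit Arguments.
Unset Strict Implicit.
Unset Printing Implicit Defensive.
Import Order.TTheory GRing.Theory Num.Theory.
Import numFieldNormedType.Exports.
Local Open Scope classical_set_scope.
Local Open Scope ring_scope.

(* The library's ['J f x] is for maps between row vectors and is the transpose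
   of the usual Jacobian. *)
Definition jacobian_cv (R : realType) (n : nat) (F : 'cV[R]_n -> 'cV[R]_n)
    (x : 'cV[R]_n) : 'M[R]_n :=
  \matrix_(i, j) 'D_(delta_mx j 0) (fun y => F y i 0) x.

Fixpoint class_C (R : realType) (m n : nat) (k : nat)
    (f : 'cV[R]_m -> 'cV[R]_n) : Prop :=
  if k is k'.+1 then
    (forall x, differentiable f x) /\ (forall v, class_C k' ('D_v f))
  else continuous f.

Definition smooth (R : realType) (m n : nat) (f : 'cV[R]_m -> 'cV[R]_n) : Prop :=
  forall k, class_C k f.

(* [ginv] is meant to be the inverse of [z |-> z - mu z]. *)
Definition Fc (R : realType) (n : nat) (M : 'M[R]_n) (q : 'cV[R]_n)
    (mu ginv : 'cV[R]_n -> 'cV[R]_n) (alpha beta : R) (c : nat)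
    (x : 'cV[R]_n) : 'cV[R]_n :=
  let Omega : 'M[R]_n := alpha%:M in
  let A : 'M[R]_n := beta *: M in
  let z := ginv (beta *: (map_mx Num.norm x + x)) in
  (Omega + A) *m x
  - (Omega - A) *m map_mx (fun t => Num.sqrt (t ^+ 2 + expR (- c%:R))) x
  + M *m mu z + q.

(* The sign in the first substep is + for [s = false] and - for [s = true]. *)
Definition first_substep (R : realType) (n : nat) (F : 'cV[R]_n -> 'cV[R]_n)
    (s : bool) (x : 'cV[R]_n) : 'cV[R]_n :=
  x + (-1) ^+ s *: (invmx (jacobian_cv F x) *m F x).

Definition next_substep (R : realType) (n : nat) (F : 'cV[R]_n -> 'cV[R]_n)
    (x y : 'cV[R]_n) : 'cV[R]_n :=
  y - invmx (jacobian_cv F x) *m F y.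

(* With y_1 = [first_substep F s x], the j-th iterate of [next_substep F x] on
   y_1 is y_(j+1) for j < m, and the m-th one is the new point. *)
Definition multistep (R : realType) (n : nat) (F : 'cV[R]_n -> 'cV[R]_n)
    (s : bool) (m : nat) (x : 'cV[R]_n) : 'cV[R]_n :=
  iter m (next_substep F x) (first_substep F s x).

Definition converges_with_order (R : realType) (n : nat) (p : nat)
    (x : nat -> 'cV[R]_n) (a : 'cV[R]_n) : Prop :=
  x @ \oo --> a /\
  (fun k => x k.+1 - a) =O_\oo (fun k => `|x k - a| ^+ p : R^o).

(* Main.v *)
Require Import Defs.
From HB Require Import structures.
From mathcomp Require Import all_boot all_order all_algebra.
From mathcomp Require Import all_classical all_reals all_analysis.
From mathcomp Require Import ring lra.
Set Implicit Arguments.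
Unset Strict Implicit.
Unset Printing Implicit Defensive.
Import Order.TTheory GRing.Theory Num.Theory.
Import numFieldNormedType.Exports.
Local Open Scope classical_set_scope.
Local Open Scope ring_scope.

(** Put [a := xstar], [e := x - a], [J := F'(x)] and [h := J^-1 F(x)].  A
    substep started at [y] has error
    [y - a - J^-1 F(y) = J^-1 (J (y - a) - (F(y) - F(a)))], which is
    [O((|y - a| + |e|) |y - a|)] because [F'] is Lipschitz near [a]: each
    substep gains one order.  With the minus sign the first substep is itself
    of this form with [y = x], so it has error [O(|e|^2)].  With the plus sign
    [x + h] is only [O(|e|)] away from [a], but the second substep gains two
    orders at once: since [h = e + O(|e|^2)] and [F(x - e) = 0],
    [J (e + h) - F(x + h)] equals, up to [O(|e|^3)], the central difference
    [- (F(x + e) - F(x - e) - 2 J e)], which is [O(|e|^3)] for [F] of class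
    [C^3].  In both cases the error is cubic after two substeps, hence of
    order [m + 2] after [m + 1] substeps. *)

(** * Entrywise norm bounds and the mean value inequality *)

Lemma mx_coord_le_norm (R : realType) (m n : nat) (A : 'M[R]_(m, n)) i j :
  `|A i j| <= `|A|.
Proof.
rewrite [leRHS]mx_normrE.
exact: (le_bigmax_cond 0 (fun ij : 'I_m * 'I_n => `|A ij.1 ij.2|) (j := (i, j))).
Qed.

Lemma mx_norm_le_coord (R : realType) (m n : nat) (A : 'M[R]_(m, n)) (C : R) :
  0 <= C -> (forall i j, `|A i j| <= C) -> `|A| <= C.
Proof.
move=> C_ge0 AC; rewrite [leLHS]mx_normrE.
by apply/bigmax_leP; split => // -[i j] _; exact: AC.
Qed.

Lemma is_derive_line (R : realType) (V W : normedModType R) (f : V -> W)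
    (x v : V) (t : R) :
  derivable f (x + t *: v) v ->
  is_derive t 1 (fun u : R => f (x + u *: v)) ('D_v f (x + t *: v)).
Proof.
have E : (fun h : R => h^-1 *: (((fun u : R => f (x + u *: v)) \o shift t) (h *: 1)
             - f (x + t *: v))) =
         (fun h : R => h^-1 *: ((f \o shift (x + t *: v)) (h *: v) - f (x + t *: v))).
  apply/funext => h /=; congr (_ *: (f _ - _)).
  by rewrite scalerDl addrCA /GRing.scale /= mulr1.
move=> df; split; first by rewrite /derivable E.
by rewrite /derive E.
Qed.

(** The scalar mean value theorem is applied to each entry. As the norm is the maximum over entries,
    the intermediate point may differ from entry to entry and [C] does not grow with [n]. *)
Lemma norm_sub_le_of_derive (R : realType) (n : nat) (f df : R -> 'cV[R]_n) (C : R) :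
  (forall t : R, is_derive t 1 f (df t)) ->
  (forall t, 0 <= t <= 1 -> `|df t| <= C) -> `|f 1 - f 0| <= C.
Proof.
move=> fdf dfC.
have C_ge0 : 0 <= C by apply: le_trans (dfC 0 _); rewrite ?lexx ?ler01.
apply: mx_norm_le_coord => // i j.
have dfij (t : R) : is_derive t 1 (fun u => f u i j) (df t i j).
  have fD : derivable f t 1 by have [] := fdf t.
  split; first exact: (derivable_mxP _ _ _).1.
  by have <- := @derive_val _ _ _ _ _ _ _ (fdf t); rewrite derive_mx// mxE.
have [|t] := MVT_segment ler01 (fun t _ => dfij t).
  by apply: derivable_within_continuous => t _; have [] := dfij t.
rewrite in_itv/= => t01 E.
rewrite !mxE E subr0 mulr1; apply: le_trans (dfC _ t01).
exact: mx_coord_le_norm.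
Qed.

(** * Directional derivatives, the Jacobian and the classes $C^k$ *)

Lemma derive_linear_comb (R : realType) (m n : nat) (f : 'cV[R]_m -> 'cV[R]_n)
    (x v : 'cV[R]_m) :
  differentiable f x ->
  'D_v f x = \sum_i v i 0 *: 'D_(delta_mx i 0) f x.
Proof.
move=> df; rewrite deriveE// {1}[v]matrix_sum_delta raddf_sum/=.
by apply: eq_bigr => i _; rewrite big_ord1 linearZ deriveE.
Qed.

Lemma jacobian_cv_mulmx (R : realType) (n : nat) (F : 'cV[R]_n -> 'cV[R]_n)
    (x v : 'cV[R]_n) :
  differentiable F x -> jacobian_cv F x *m v = 'D_v F x.
Proof.
move=> dF; rewrite (derive_linear_comb _ dF); apply/colP => i.
rewrite !mxE summxE; apply: eq_bigr => j _; rewrite !mxE mulrC.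
by rewrite (derive_mx (diff_derivable dF)) mxE.
Qed.

Lemma class_C_continuous (R : realType) (m n k : nat) (f : 'cV[R]_m -> 'cV[R]_n) :
  class_C k f -> continuous f.
Proof.
by case: k => // k [df _] x; apply: differentiable_continuous.
Qed.

Lemma class_CW (R : realType) (m n k : nat) (f : 'cV[R]_m -> 'cV[R]_n) :
  class_C k.+1 f -> class_C k f.
Proof.
elim: k f => [|k IHk] f; first exact: class_C_continuous.
by move=> [df Df]; split => // v; apply: IHk.
Qed.

(** * Balls around a point and segments inside them *)

(** Local properties are phrased through small radii, so that several can be intersected and one
    common radius extracted with [filter_ex]. *)
Lemma near0_ball (R : realType) (V : normedModType R) (a : V) (P : V -> Prop) :
  (\forall x \near a, P x) ->
  \forall r \near 0^'+, forall x, `|x - a| < r -> P x.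
Proof.
move=> /nbhs_normP[r0/= r0_gt0 r0P].
apply: filterS (nbhs_right_lt r0_gt0) => r rr0 x xar.
by apply: r0P; rewrite /= distrC (lt_trans xar).
Qed.

Lemma norm_segment_le (R : realType) (V : normedModType R) (a x y : V) (r t : R) :
  0 <= t <= 1 -> `|x - a| <= r -> `|y - a| <= r -> `|y + t *: (x - y) - a| <= r.
Proof.
move=> /andP[t0 t1] xa ya.
have -> : y + t *: (x - y) - a = (1 - t) *: (y - a) + t *: (x - a).
  rewrite scalerBl scale1r -[RHS]addrA [- _ + _]addrC -scalerBr opprB subrKA.
  by rewrite addrAC.
apply: le_trans (ler_normD _ _) _; rewrite !normrZ !ger0_norm ?subr_ge0//.
apply: (@le_trans _ _ ((1 - t) * r + t * r)); last by rewrite -mulrDl subrK mul1r.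
by apply: lerD; apply: ler_wpM2l => //; rewrite subr_ge0.
Qed.

Lemma norm_segment_lt (R : realType) (V : normedModType R) (a x y : V) (r t : R) :
  0 <= t <= 1 -> `|x - a| < r -> `|y - a| < r -> `|y + t *: (x - y) - a| < r.
Proof.
move=> t01 xa ya; apply: (@le_lt_trans _ _ (Num.max `|x - a| `|y - a|)).
  by apply: norm_segment_le; rewrite // le_max lexx ?orbT.
by rewrite gt_max xa ya.
Qed.

Lemma norm_midpoint_lt (R : realType) (n : nat) (a x v : 'cV[R]_n) (r : R) :
  `|x + v - a| < r -> `|x - v - a| < r -> `|x - a| < r.
Proof.
move=> xva xvna.
have -> : x = (x - v) + 2^-1 *: (x + v - (x - v)).
  by apply/colP => i; rewrite !mxE; field.
apply: norm_segment_lt => //.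
by rewrite invr_ge0 ler0n/= invf_le1// ler1n.
Qed.

Lemma derive_opp (R : realType) (V W : normedModType R) (f : V -> W) (x v : V) :
  differentiable f x -> 'D_(- v) f x = - 'D_v f x.
Proof. by move=> df; rewrite !deriveE// linearN. Qed.

(** Used with [derive_linear_comb]: bounds for the finitely many partial derivatives become a bound
    for ['D_v], uniform in the direction [v]. *)
Lemma norm_linear_comb_le (R : realType) (m n : nat) (v : 'cV[R]_m)
    (w : 'I_m -> 'cV[R]_n) (C : 'I_m -> R) (D : R) :
  (forall i, `|w i| <= C i * D) ->
  `|\sum_i v i 0 *: w i| <= (\sum_i C i) * D * `|v|.
Proof.
move=> wC; apply: le_trans (ler_norm_sum _ _ _) _.
rewrite -mulrA mulr_suml; apply: ler_sum => i _.
rewrite normrZ mulrC mulrA; apply: ler_pM => //; exact: mx_coord_le_norm.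
Qed.

(** * Local Lipschitz and Taylor-type estimates *)

Section LocalBounds.
Context (R : realType) (m n : nat) (a : 'cV[R]_m).
Implicit Types f : 'cV[R]_m -> 'cV[R]_n.

(** By continuity each partial derivative stays near [a] below its norm at [a] plus 1; the mean
    value inequality then applies on the segment from [y] to [x], which stays in the ball. *)
Lemma class_C1_lipschitz_near f : class_C 1 f ->
  exists2 K, 0 <= K & \forall r \near 0^'+, forall x y,
    `|x - a| < r -> `|y - a| < r -> `|f x - f y| <= K * `|x - y|.
Proof.
move=> [df cDf].
exists (\sum_(i < m) (`|'D_(delta_mx i 0) f a| + 1)).
  by apply: sumr_ge0 => i _; rewrite addr_ge0.
have Da (i : 'I_m) : \forall x \near a,
    `|'D_(delta_mx i 0) f x| <= `|'D_(delta_mx i 0) f a| + 1.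
  have cDa : {for a, continuous ('D_(delta_mx i 0) f)} := cDf (delta_mx i 0) a.
  have := cvgr_norm_le _ cDa (`|'D_(delta_mx i 0) f a| + 1).
  by rewrite ltrDl; apply.
apply: filterS (near0_ball (filter_forall _ Da)) => r Hr x y xa ya.
have := @norm_sub_le_of_derive R n (fun t => f (y + t *: (x - y)))
  (fun t => 'D_(x - y) f (y + t *: (x - y))).
rewrite scale1r scale0r addr0 subrKC; apply.
  by move=> t; apply: is_derive_line; exact: diff_derivable.
move=> t t01; rewrite derive_linear_comb// -[X in X * _]mulr1.
by apply: norm_linear_comb_le => i; rewrite mulr1; apply: Hr; exact: norm_segment_lt.
Qed.

Lemma derive_lipschitz_near f : class_C 2 f ->
  exists2 K, 0 <= K & \forall r \near 0^'+, forall x y v,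
    `|x - a| < r -> `|y - a| < r ->
    `|'D_v f x - 'D_v f y| <= K * `|x - y| * `|v|.
Proof.
move=> [df cDf].
have /fin_all_exists2[K K_ge0 HK] :=
  fun i : 'I_m => class_C1_lipschitz_near (cDf (delta_mx i 0)).
exists (\sum_i K i); first by apply: sumr_ge0.
apply: filterS (filter_forall _ HK) => r Hr x y v xa ya.
rewrite !derive_linear_comb// -sumrB; under eq_bigr do rewrite -scalerBr.
by apply: norm_linear_comb_le => i; apply: Hr.
Qed.

(** The derivative is frozen at a third point [z] because all substeps reuse the Jacobian at one
    point. Along the segment from [y] to [x], within [d] of [z], it varies by at most $K d
    |x-y|$. *)
Lemma linearization_near f : class_C 2 f ->
  exists2 K, 0 <= K & \forall r \near 0^'+, forall x y z d,
    `|x - a| < r -> `|y - a| < r -> `|z - a| < r ->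
    `|x - z| <= d -> `|y - z| <= d ->
    `|f x - f y - 'D_(x - y) f z| <= K * d * `|x - y|.
Proof.
move=> f2; have [K K_ge0 HK] := derive_lipschitz_near f2.
have df := f2.1; exists K => //.
apply: filterS HK => r Hr x y z d xa ya za xz yz.
(* [0 + t *: c] matches [is_derive_line] for the identity. *)
have := @norm_sub_le_of_derive R n
  (fun t => f (y + t *: (x - y)) - (0 + t *: 'D_(x - y) f z))
  (fun t => 'D_(x - y) f (y + t *: (x - y)) - 'D_(x - y) f z).
rewrite !scale1r !scale0r !addr0 subr0 add0r subrKC addrAC; apply.
  move=> t; apply: is_deriveB.
    by apply: is_derive_line; exact: diff_derivable.
  rewrite -[X in is_derive _ _ _ X](derive_id (0 + t *: 'D_(x - y) f z)).
  exact: (@is_derive_line _ _ _ id).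
move=> t t01; apply: le_trans (Hr _ _ _ _ za) _.
  exact: norm_segment_lt.
by rewrite ler_wpM2r// ler_wpM2l//; exact: norm_segment_le.
Qed.

(** The function $t \mapsto f(x+tv)+f(x-tv)$ has derivative $D_v f(x+tv)-D_v f(x-tv)$, whose
    arguments are $2tv$ apart; hence the factor 2. *)
Lemma second_difference_near f : class_C 2 f ->
  exists2 K, 0 <= K & \forall r \near 0^'+, forall x v,
    `|x + v - a| < r -> `|x - v - a| < r ->
    `|f (x + v) + f (x - v) - f x *+ 2| <= K * `|v| ^+ 2.
Proof.
move=> f2; have [K K_ge0 HK] := derive_lipschitz_near f2.
exists (2 * K); first by rewrite mulr_ge0.
have df := f2.1.
apply: filterS HK => r Hr x v xva xvna.
have := @norm_sub_le_of_derive R n (fun t => f (x + t *: v) + f (x + t *: - v))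
  (fun t => 'D_v f (x + t *: v) + 'D_(- v) f (x + t *: - v)).
rewrite !scale1r !scale0r !addr0 mulr2n; apply.
  by move=> t; apply: is_deriveD; apply: is_derive_line; exact: diff_derivable.
move=> t t01.
have t_norm : `|t| <= 1 by case/andP: t01 => t0 ?; rewrite ger0_norm.
have xa := norm_midpoint_lt xva xvna.
rewrite (derive_opp _ (df _)).
apply: le_trans (Hr _ _ _ _ _) _.
- by have := norm_segment_lt t01 xva xa; rewrite [x + v - x]addrC addKr.
- by have := norm_segment_lt t01 xvna xa; rewrite [x - v - x]addrC addKr.
rewrite scalerN opprD opprK addrACA subrr add0r -scalerDl normrZ.
rewrite expr2 !mulrA ler_wpM2r// ler_wpM2r// [leRHS]mulrC ler_wpM2l//.
apply: le_trans (ler_normD _ _) _; rewrite -[leRHS]/(1 + 1).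
exact: lerD.
Qed.

(** The derivative of $f(x+tv)-f(x-tv)-2t D_v f(x)$ in $t$ is the second difference of $D_v f$ with
    step $tv$, of size $O(|v|^2)$ for each partial derivative; the expansion of $v$ adds one more
    factor $|v|$. *)
Lemma central_difference_near f : class_C 3 f ->
  exists2 K, 0 <= K & \forall r \near 0^'+, forall x v,
    `|x + v - a| < r -> `|x - v - a| < r ->
    `|f (x + v) - f (x - v) - 'D_v f x *+ 2| <= K * `|v| ^+ 3.
Proof.
move=> [df f2].
have /fin_all_exists2[K K_ge0 HK] :=
  fun i : 'I_m => second_difference_near (f2 (delta_mx i 0)).
exists (\sum_i K i); first by apply: sumr_ge0.
apply: filterS (filter_forall _ HK) => r Hr x v xva xvna.
have := @norm_sub_le_of_derive R n
  (fun t => f (x + t *: v) - f (x + t *: - v) - (0 + t *: ('D_v f x *+ 2)))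
  (fun t => 'D_v f (x + t *: v) - 'D_(- v) f (x + t *: - v) - 'D_v f x *+ 2).
rewrite !scale1r !scale0r !addr0 subrr !subr0 add0r; apply.
  move=> t; apply: is_deriveB.
    by apply: is_deriveB; apply: is_derive_line; exact: diff_derivable.
  rewrite -[X in is_derive _ _ _ X](derive_id (0 + t *: ('D_v f x *+ 2))).
  exact: (@is_derive_line _ _ _ id).
move=> t t01.
have t_norm : `|t| <= 1 by case/andP: t01 => t0 ?; rewrite ger0_norm.
have xa := norm_midpoint_lt xva xvna.
rewrite (derive_opp _ (df _)) opprK.
rewrite !derive_linear_comb// -sumrMnl -big_split -sumrB /=.
under eq_bigr do rewrite scalerMnr -scalerDr -scalerBr.
rewrite exprSr mulrA; apply: norm_linear_comb_le => i.
rewrite scalerN; apply: le_trans (Hr i x (t *: v) _ _) _.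
- by have := norm_segment_lt t01 xva xa; rewrite [x + v - x]addrC addKr.
- by have := norm_segment_lt t01 xvna xa; rewrite [x - v - x]addrC addKr scalerN.
- rewrite ler_wpM2l// lerXn2r ?nnegrE//.
  by rewrite normrZ -[leRHS]mul1r ler_wpM2r.
Qed.

End LocalBounds.

(** * Invertibility of the Jacobian near the solution *)

Lemma mulmx_norm_bounded (R : realType) (m n : nat) (A : 'M[R]_(m, n)) :
  exists2 B, 0 <= B & forall v : 'cV[R]_n, `|A *m v| <= B * `|v|.
Proof.
exists (\sum_j `|col j A|); first exact: sumr_ge0.
move=> v; have -> : A *m v = \sum_j v j 0 *: col j A.
  apply/colP => i; rewrite !mxE summxE; apply: eq_bigr => j _.
  by rewrite !mxE mulrC.
rewrite -[X in X * _]mulr1; apply: norm_linear_comb_le => j.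
by rewrite mulr1.
Qed.

(** [A] kills every column of its [cokermx], so injectivity makes that matrix zero. *)
Lemma unitmx_inj (K : fieldType) (n : nat) (A : 'M[K]_n) :
  (forall v : 'cV[K]_n, A *m v = 0 -> v = 0) -> A \in unitmx.
Proof.
move=> Ainj; rewrite -row_full_unit -cokermx_eq0; apply/eqP/matrixP => i j.
have /colP/(_ i) : col j (cokermx A) = 0.
  by apply: Ainj; rewrite colE mulmxA mulmx_coker mul0mx.
by rewrite !mxE.
Qed.

Lemma jacobian_cv_unit_near (R : realType) (n : nat) (F : 'cV[R]_n -> 'cV[R]_n)
    (a : 'cV[R]_n) :
  class_C 2 F -> jacobian_cv F a \in unitmx ->
  exists2 B, 0 <= B & \forall r \near 0^'+, forall x, `|x - a| < r ->
    jacobian_cv F x \in unitmx /\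
    forall w : 'cV[R]_n, `|invmx (jacobian_cv F x) *m w| <= B * `|w|.
Proof.
move=> F2 Ja; have dF := F2.1.
have [B B_ge0 HB] := mulmx_norm_bounded (invmx (jacobian_cv F a)).
have [K K_ge0 HK] := derive_lipschitz_near a F2.
exists (2 * B); first by rewrite mulr_ge0.
(* Below this radius $BK|x-a| \le 1/2$, so the perturbation term is at most $|v|/2$ and is absorbed
   on the left, doubling [B]. The [+ 1] keeps the denominator positive. *)
have BK_gt0 : 0 < (2 * (B * K + 1))^-1.
  by rewrite invr_gt0 mulr_gt0// ltr_wpDl// mulr_ge0.
apply: filterS2 (nbhs_right_lt BK_gt0) HK => r r_lt Hr x xa.
(* [J(x)] is a small perturbation of [J(a)], hence bounded below. *)
have Jlow (v : 'cV[R]_n) : `|v| <= 2 * B * `|jacobian_cv F x *m v|.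
  have aa : `|a - a| < r by rewrite subrr normr0; exact: le_lt_trans xa.
  have vE : v = invmx (jacobian_cv F a) *m (jacobian_cv F x *m v) -
    invmx (jacobian_cv F a) *m ('D_v F x - 'D_v F a).
    by rewrite -mulmxBr -!jacobian_cv_mulmx// subKr mulKmx.
  have tri : `|v| <= `|invmx (jacobian_cv F a) *m (jacobian_cv F x *m v)| +
      `|invmx (jacobian_cv F a) *m ('D_v F x - 'D_v F a)|.
    by rewrite {1}vE ler_normB.
  have half : B * K * `|x - a| <= 2^-1.
    have xa2 : 2 * (B * K + 1) * `|x - a| < 1.
      rewrite -ltr_pdivlMl ?mulr1 ?(lt_trans xa)//.
      by rewrite -invr_gt0.
    have := normr_ge0 (x - a); lra.
  have hi : `|invmx (jacobian_cv F a) *m ('D_v F x - 'D_v F a)| <= 2^-1 * `|v|.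
    apply: le_trans (HB _) _.
    apply: le_trans (ler_wpM2l B_ge0 (Hr _ _ v xa aa)) _.
    by rewrite !mulrA ler_wpM2r.
  have lo := HB (jacobian_cv F x *m v).
  lra.
have Jx : jacobian_cv F x \in unitmx.
  apply: unitmx_inj => v Jv; apply/eqP; rewrite -normr_le0.
  by have := Jlow v; rewrite Jv normr0 mulr0.
by split => // w; apply: le_trans (Jlow _) _; rewrite mulKVmx.
Qed.

(** * Error orders of the substeps *)

Definition error_order (R : realType) (n : nat) (a : 'cV[R]_n) (p : nat)
    (G : 'cV[R]_n -> 'cV[R]_n) : Prop :=
  exists2 D, 0 <= D & \forall x \near a, `|G x - a| <= D * `|x - a| ^+ p.

Lemma near_dist_lt (R : realType) (V : normedModType R) (a : V) (C r : R) :
  0 <= C -> 0 < r -> \forall x \near a, C * `|x - a| < r.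
Proof.
move=> C_ge0 r_gt0; have C1_gt0 : 0 < C + 1 by rewrite ltr_wpDl.
apply/nbhs_normP; exists (r / (C + 1)); first by rewrite /= divr_gt0.
move=> x /=; rewrite distrC ltr_pdivlMr// mulrC; apply: le_lt_trans.
by rewrite ler_wpM2r// lerDl.
Qed.

Section Substeps.
Context (R : realType) (n : nat) (F : 'cV[R]_n -> 'cV[R]_n) (a : 'cV[R]_n).
Hypotheses (F3 : class_C 3 F) (Fa : F a = 0) (Ja : jacobian_cv F a \in unitmx).
Local Notation J := (jacobian_cv F).

Let F2 : class_C 2 F. Proof. exact: class_CW. Qed.
Let dF x : differentiable F x. Proof. by have [] := F3. Qed.

Lemma next_substep_order (p : nat) (G : 'cV[R]_n -> 'cV[R]_n) :
  error_order a p.+1 G ->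
  error_order a p.+2 (fun x => next_substep F x (G x)).
Proof.
move=> [D D_ge0 HD].
have [B B_ge0 HB] := jacobian_cv_unit_near F2 Ja.
have [K K_ge0 HK] := linearization_near a F2.
have [r [[r_gt0 {}HB] {}HK]] :=
  filter_ex (filterI (filterI (nbhs_right_gt 0) HB) HK).
exists (B * (K * (D + 1) * D)); first by rewrite !mulr_ge0// addr_ge0.
near=> x.
have xD : `|G x - a| <= D * `|x - a| ^+ p.+1 by near: x.
have x1 : `|x - a| < 1.
  by rewrite -[ltLHS]mul1r; near: x; apply: (@near_dist_lt _ _ a 1 1).
(* This single bound puts both [x] and [G x] in the ball; $(D+1)|x-a|$ also bounds the distances
   from [x] to [G x] and to [a]. *)
have xr : (D + 1) * `|x - a| < r.
  by near: x; apply: (@near_dist_lt _ _ a (D + 1) r); rewrite ?addr_ge0.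
have xDe : `|G x - a| <= D * `|x - a|.
  apply: le_trans xD _; rewrite ler_wpM2l// exprS -[leRHS]mulr1 ler_wpM2l//.
  by rewrite exprn_ile1// ltW.
have xa : `|x - a| < r.
  by apply: le_lt_trans xr; rewrite mulrDl mul1r lerDr mulr_ge0.
have Gxa : `|G x - a| < r.
  by apply: le_lt_trans xr; rewrite mulrDl mul1r (le_trans xDe)// lerDl.
have [Jx {}HB] := HB _ xa.
have -> : next_substep F x (G x) - a =
    - (invmx (J x) *m (F (G x) - F a - 'D_(G x - a) F x)).
  rewrite -jacobian_cv_mulmx// mulmxBr mulKmx// Fa subr0 opprB.
  by rewrite /next_substep addrAC.
rewrite normrN; apply: le_trans (HB _) _; rewrite -!mulrA ler_wpM2l//.
apply: le_trans (HK (G x) a x ((D + 1) * `|x - a|) _ _ _ _ _) _ => //.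
- by rewrite subrr normr0.
- rewrite -[G x](subrK a) -addrA; apply: le_trans (ler_normD _ _) _.
  by rewrite mulrDl mul1r [`|a - x|]distrC lerD2r.
- by rewrite distrC mulrDl mul1r lerDr mulr_ge0.
rewrite -!mulrA ler_wpM2l// ler_wpM2l ?addr_ge0//.
by rewrite [in leRHS]exprS mulrCA ler_wpM2l.
Unshelve. all: by end_near. Qed.

Lemma first_two_substeps_order (s : bool) :
  error_order a 3 (fun x => next_substep F x (first_substep F s x)).
Proof.
case: s.
  (* With the minus sign the first substep is [next_substep F x x], so the gain of one order applies
     twice from the identity, of order 1. *)
  have id1 : error_order a 1 id by exists 1 => //; near=> x; rewrite mul1r.
  have [D D_ge0 HD] := next_substep_order (next_substep_order id1).
  by exists D => //; apply: filterS HD => x; rewrite /first_substep scaleN1r.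
have [B B_ge0 HB] := jacobian_cv_unit_near F2 Ja.
have [K K_ge0 HK] := linearization_near a F2.
have [T T_ge0 HT] := central_difference_near a F3.
have [r [[[r_gt0 {}HB] {}HK] {}HT]] :=
  filter_ex (filterI (filterI (filterI (nbhs_right_gt 0) HB) HK) HT).
have BK_ge0 : 0 <= B * K by rewrite mulr_ge0.
exists (B * (T + K * (1 + B * K) * (B * K))).
  by rewrite mulr_ge0// addr_ge0// !mulr_ge0// addr_ge0.
near=> x.
have x1 : `|x - a| < 1.
  by rewrite -[ltLHS]mul1r; near: x; apply: (@near_dist_lt _ _ a 1 1).
(* The two new points satisfy $|x+e-a| = 2|e|$ and $|x+h-a| \le |e|+|h| \le (2+BK)|e|$. *)
have xr : (2 + B * K) * `|x - a| < r.
  by near: x; apply: (@near_dist_lt _ _ a (2 + B * K) r); rewrite ?addr_ge0.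
set e := x - a in x1 xr *.
have xa : `|e| < r.
  by apply: le_lt_trans xr; rewrite -[leLHS]mul1r ler_wpM2r//; lra.
have [Jx {}HB] := HB _ xa.
pose h := invmx (J x) *m F x.
pose u := h - e.
have u_le : `|u| <= B * K * `|e| ^+ 2.
  have -> : u = invmx (J x) *m (F x - F a - 'D_(x - a) F x).
    by rewrite -jacobian_cv_mulmx// mulmxBr mulKmx// Fa subr0.
  apply: le_trans (HB _) _; rewrite -!mulrA ler_wpM2l//.
  apply: le_trans (HK x a x `|e| _ _ _ _ _) _ => //.
  - by rewrite subrr normr0.
  - by rewrite subrr normr0.
  - by rewrite distrC.
  - by rewrite mulrA.
have h_le : `|h| <= (1 + B * K) * `|e|.
  rewrite -[h](subrK e) -/u; apply: le_trans (ler_normD _ _) _.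
  rewrite addrC mulrDl mul1r lerD2l (le_trans u_le)// ler_wpM2l//.
  by rewrite expr2 -[leRHS]mulr1 ler_wpM2l// ltW.
have xe : `|x + e - a| < r.
  rewrite addrAC; apply: le_lt_trans (ler_normD _ _) (le_lt_trans _ xr).
  have := mulr_ge0 BK_ge0 (normr_ge0 e); rewrite -/e; lra.
have xh : `|x + h - a| < r.
  rewrite addrAC; apply: le_lt_trans (ler_normD _ _) (le_lt_trans _ xr).
  by rewrite -/e; lra.
have xeE : x - e = a by rewrite subKr.
(* Since $F(x-e)=F(a)=0$, $Jh=F(x)$ and $2Je+J(h-e)=J(e+h)$, the error splits into a central
   difference with step $e$ and a linearization error from $x+e$ to $x+h$, whose increment $u=h-e$
   is already quadratic. *)
have -> : next_substep F x (first_substep F false x) - a =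
    - (invmx (J x) *m ((F (x + e) - F (x - e) - 'D_e F x *+ 2) +
      (F (x + h) - F (x + e) - 'D_(x + h - (x + e)) F x))).
  rewrite xeE Fa subr0.
  have -> : x + h - (x + e) = h - e by rewrite opprD addrACA subrr add0r.
  have Jhe : J x *m (h - e) = F x - J x *m e by rewrite mulmxBr mulKVmx.
  rewrite -!jacobian_cv_mulmx// Jhe.
  have -> : F (x + e) - J x *m e *+ 2 + (F (x + h) - F (x + e) - (F x - J x *m e))
      = F (x + h) - F x - J x *m e.
    move: (F _) (J x *m e) (F _) (F _) => f1 je f2 f3.
    by apply/colP => i; rewrite !mxE; ring.
  rewrite !mulmxBr !mulKmx// -/h /next_substep /first_substep expr0 scale1r -/h.
  have alg (w h' : 'cV[R]_n) : x + h' - w - a = - (w - h' - (x - a)).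
    by apply/colP => i; rewrite !mxE; ring.
  exact: alg.
rewrite normrN; apply: le_trans (HB _) _; rewrite -!mulrA ler_wpM2l//.
rewrite mulrDl; apply: le_trans (ler_normD _ _) _; apply: lerD.
  by apply: HT => //; rewrite xeE subrr normr0.
apply: le_trans (HK (x + h) (x + e) x ((1 + B * K) * `|e|) _ _ _ _ _) _ => //.
- by rewrite addrAC subrr add0r.
- by rewrite addrAC subrr add0r mulrDl mul1r lerDl mulr_ge0.
have -> : x + h - (x + e) = u by rewrite opprD addrACA subrr add0r.
apply: le_trans (ler_wpM2l _ u_le) _; first by rewrite !mulr_ge0// addr_ge0.
by rewrite le_eqVlt; apply/orP; left; apply/eqP; ring.
Unshelve. all: by end_near. Qed.

Lemma multistep_order (s : bool) (m : nat) :
  error_order a m.+3 (multistep F s m.+1).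
Proof.
elim: m => [|m IHm]; first exact: first_two_substeps_order.
exact: next_substep_order.
Qed.

End Substeps.

(** * Convergence of the iteration *)

(** Order at least two makes [T] at least halve the error near [a]: the iterates stay in a ball
    where [P] and the error bound hold, and converge geometrically. *)
Lemma error_order_iterates (R : realType) (n : nat) (a : 'cV[R]_n) (p : nat)
    (T : 'cV[R]_n -> 'cV[R]_n) (P : 'cV[R]_n -> Prop) :
  error_order a p.+2 T -> (\forall x \near a, P x) ->
  \forall x0 \near a, forall x : nat -> 'cV[R]_n,
    x 0%N = x0 -> (forall k, x k.+1 = T (x k)) ->
    (forall k, P (x k)) /\ converges_with_order p.+2 x a.
Proof.
move=> [D D_ge0 HD] HP.
have [r [[[r_gt0 r1] {}HD] {}HP]] := filter_ex (filterI (filterI (filterI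
  (nbhs_right_gt 0) (nbhs_right_lt ltr01)) (near0_ball HD)) (near0_ball HP)).
near=> x0 => x xx0 xS.
have x0r : `|x0 - a| < r.
  by rewrite -[ltLHS]mul1r; near: x0; apply: (@near_dist_lt _ _ a 1 r).
have x0D : D * `|x0 - a| < 2^-1.
  by near: x0; apply: (@near_dist_lt _ _ a D 2^-1); rewrite // invr_gt0.
(* As $r<1$, $|x_k-a|^{p+1} \le |x_k-a| \le |x_0-a|$, so the factor $D|x_k-a|^{p+1}$ of one step is
   at most $1/2$. *)
have xk k : `|x k - a| <= `|x0 - a| * 2^-1 ^+ k.
  elim: k => [|k IHk]; first by rewrite xx0 expr0 mulr1.
  have xk0 : `|x k - a| <= `|x0 - a|.
    by apply: le_trans IHk _; rewrite ler_piMr// exprn_ile1// invf_le1// ler1n.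
  have xkr := le_lt_trans xk0 x0r.
  rewrite xS exprSr mulrA; apply: le_trans (HD _ xkr) _.
  apply: le_trans (ler_wpM2r _ IHk); last by rewrite invr_ge0.
  rewrite exprS mulrCA ler_wpM2l//; apply: le_trans (ltW x0D).
  rewrite ler_wpM2l//; apply: le_trans xk0.
  by rewrite exprS ler_piMr// exprn_ile1// ltW// (lt_trans xkr).
have xr k : `|x k - a| < r.
  apply: le_lt_trans x0r; apply: le_trans (xk k) _.
  by rewrite ler_piMr// exprn_ile1// invf_le1// ler1n.
split; first by move=> k; exact: HP.
split.
  have half_lt1 : `|2^-1 : R| < 1.
    by rewrite ger0_norm ?invr_ge0// invf_lt1// ltr1n.
  have : `|x k - a| @[k --> \oo] --> (0 : R).
    apply: squeeze_cvgr (cvg_cst _) (cvg_geometric `|x0 - a| half_lt1).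
    by near=> k; rewrite normr_ge0; exact: xk.
  by move=> /norm_cvg0/subr_cvg0.
apply/eqOP; near=> K; near=> k.
rewrite xS; apply: le_trans (HD _ (xr k)) _.
rewrite normrX normr_id ler_wpM2r ?exprn_ge0//.
Unshelve. all: by end_near. Qed.

Theorem theorem3 (R : realType) (n : nat) (M : 'M[R]_n) (q : 'cV[R]_n)
    (mu ginv : 'cV[R]_n -> 'cV[R]_n)
    (g_ginv : cancel (fun z => z - mu z) ginv)
    (ginv_g : cancel ginv (fun z => z - mu z))
    (alpha beta : R) (alpha_gt0 : 0 < alpha) (beta_gt0 : 0 < beta)
    (c : nat) (c_gt0 : (0 < c)%N)
    (F := Fc M q mu ginv alpha beta c)
    (F_smooth : smooth F)
    (xstar : 'cV[R]_n) (F_xstar : F xstar = 0)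
    (F'_xstar : jacobian_cv F xstar \in unitmx)
    (s : bool) (m : nat) (m_gt0 : (0 < m)%N) :
  \forall x0 \near xstar, forall x : nat -> 'cV[R]_n,
    x 0%N = x0 -> (forall k, x k.+1 = multistep F s m (x k)) ->
    (forall k, jacobian_cv F (x k) \in unitmx) /\
    converges_with_order (m + 2) x xstar.
Proof.
case: m m_gt0 => // m _; rewrite addn2.
(* [invmx] returns its argument when that is singular, so invertibility of the Jacobian is carried
   along the sequence as [P]. *)
apply: (@error_order_iterates _ _ _ m.+1 (multistep F s m.+1)
  (fun y => jacobian_cv F y \in unitmx)).
  exact: multistep_order (F_smooth 3) F_xstar F'_xstar s m.
have [B _ HB] := jacobian_cv_unit_near (F_smooth 2) F'_xstar.
have [r [r_gt0 {}HB]] := filter_ex (filterI (nbhs_right_gt 0) HB).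
by apply: filterS (near_dist_lt xstar ler01 r_gt0) => x; rewrite mul1r => /HB[].
Qed.
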